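(* Assume $B\subseteq A\subsetneq[m]$ and let $\rho=0$ if $B=A$, $\rho=1$ if $B\subsetneq A$. (a) If $q\ge3$, or $q=2$ and $|[m]\setminus A|\ge2$, then $\mathcal C_{\overline{\mathcal N}_2}$ is a $q$-ary $\left[\frac{2q^{|B|+|C|}(q^m-q^{|A|})}{q-1},\ 2m+|C|,\ (q^m-\rho q^{|A|})q^{|B|+|C|-1}\right]$ locally repairable code with locality $2$. (b) If $q=2$ and $|[m]\setminus A|=1$, then $\mathcal C_{\overline{\mathcal N}_2}$ is a binary $\left[2^{m+|B|+|C|},\ 2m+|C|,\ (2-\rho)2^{m+|B|+|C|-2}\right]$ locally repairable code with locality $3$.
   Context: $q$ is a prime power, $\mathbb F_q$ the field of order $q$, $\mathbb F_q^*=\mathbb F_q\setminus\{0\}$, $m\ge2$, $[m]=\{1,\dots,m\}$, $\mathrm{supp}(v)=\{i:v_i\ne0\}$. For nonempty $P\subseteq[m]$, $\Delta_P=\{v\in\mathbb F_q^m:\mathrm{supp}(v)\subseteq P\}$, $\Delta_P^c=\mathbb F_q^m\setminus\Delta_P$. $A,B,C$ are nonempty subsets of $[m]$. Let $\mathcal N_2=\{(w_2+\omega,w_3,w_1)\in\mathbb F_q^{3m}: w_1\in\Delta_A^c,\ w_2\in\Delta_B,\ w_3\in\Delta_C,\ \omega\in\{\mathbf 0,w_1\}\}$ (closed under multiplication by $\mathbb F_q^*$), let $\overline{\mathcal N}_2$ contain exactly one element of each class $\{\alpha x:\alpha\in\mathbb F_q^*\}$, $x\in\mathcal N_2$, let $G$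 be the $3m\times|\overline{\mathcal N}_2|$ matrix whose columns are the elements of $\overline{\mathcal N}_2$, and let $\mathcal C_{\overline{\mathcal N}_2}$ be the row span of $G$ over $\mathbb F_q$. The code has locality $r$ (with respect to $G$) if $r$ is the least positive integer such that every column of $G$ is an $\mathbb F_q$-linear combination of at most $r$ other columns of $G$; a $q$-ary $[n,k,d]$ locally repairable code with locality $r$ is a linear $[n,k,d]$ code (length, dimension, minimum Hamming distance) with locality $r$. *)

(* Defs.v *)
From HB Require Import structures.
From mathcomp Require Import all_boot all_order all_algebra all_field.
Set Implicit Arguments. Unset Strict Implicit. Unset Printing Implicit Defensive.
Import GRing.Theory.
Local Open Scope ring_scope.

Section Defs.
Variable F : finFieldType.

Definition inDelta (m : nat) (P : {set 'I_m}) (v : 'rV[F]_m) : bool :=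
  [forall i, (v 0 i != 0) ==> (i \in P)].

Definition N2 (m : nat) (A B C : {set 'I_m}) : {set 'rV[F]_(m + m + m)} :=
  [set x | [exists w1 : 'rV[F]_m, exists w2 : 'rV[F]_m, exists w3 : 'rV[F]_m,
     exists om : bool,
       [&& ~~ inDelta A w1, inDelta B w2, inDelta C w3 &
           x == row_mx (row_mx (w2 + (if om then w1 else 0)) w3) w1]]].

Definition is_rep_system (n : nat) (S : {set 'rV[F]_n}) (s : seq 'rV[F]_n) :=
  (forall y, y \in s -> y \in S) /\
  (forall x, x \in S ->
     count (fun y => [exists a : F, (a != 0) && (y == a *: x)]) s = 1%N).

Definition Nbar_genmx (n : nat) (s : seq 'rV[F]_n) : 'M[F]_(n, size s) :=
  \matrix_(i < n, j < size s) (s`_j) 0 i.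

Definition wt (n : nat) (c : 'rV[F]_n) : nat := #|[set j | c 0 j != 0]|.

Definition codeword (k n : nat) (G : 'M[F]_(k, n)) (c : 'rV[F]_n) : Prop :=
  exists u : 'rV[F]_k, c = u *m G.

Definition min_dist (k n : nat) (G : 'M[F]_(k, n)) (d : nat) : Prop :=
  (exists c, codeword G c /\ c != 0 /\ wt c = d) /\
  (forall c, codeword G c -> c != 0 -> (d <= wt c)%N).

Definition col_repairable (k n : nat) (G : 'M[F]_(k, n)) (j : 'I_n) (r : nat) :=
  exists (S : {set 'I_n}) (a : 'I_n -> F),
    j \notin S /\ (#|S| <= r)%N /\ col j G = \sum_(l in S) a l *: col l G.

Definition locality (k n : nat) (G : 'M[F]_(k, n)) (r : nat) : Prop :=
  (0 < r)%N /\ (forall j, col_repairable G j r) /\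
  (forall r', (0 < r')%N -> (r' < r)%N -> ~ (forall j, col_repairable G j r')).

Definition is_LRC (k0 n : nat) (G : 'M[F]_(k0, n)) (k d r : nat) : Prop :=
  \rank G = k /\ min_dist G d /\ locality G r.

End Defs.
Arguments N2 {F m} A B C.

(* Main.v *)
Require Import Defs.
From HB Require Import structures.
From mathcomp Require Import all_boot all_order all_algebra all_field.
From mathcomp Require Import mxabelem zify.
Import GRing.Theory.

(* Since B is contained in A, the parametrization of N2 by (omega, w1, w2, w3)
   is injective, which gives its cardinality. The weight of the codeword of
   u = (a, b, c), times q - 1, is the number of x in N2 with u.x <> 0. If a does
   not vanish on B or b does not vanish on C, a translation inside N2 makes all
   values of u.x equally frequent; otherwise u.x is c.w1 or (a + c).w1, and the
   count is a difference of counts over F_q^m and Delta_A. This yields all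
   weights explicitly, hence the kernel (so the dimension) and the minimum
   distance. For the locality, distinct columns are never proportional, so
   locality 1 is excluded; a column x is repaired by two others on an affine
   line x + F_q v (q >= 3), or by splitting w1 = e_i + (w1 - e_i) with both
   parts outside Delta_A (q = 2). If q = 2 and A misses a single coordinate, all
   columns have a 1 there, so two columns never suffice, while x is the sum of
   x + v, x + t and x + v + t. *)

Set Implicit Arguments. Unset Strict Implicit. Unset Printing Implicit Defensive.

(** * Scalar products and hyperplane counts *)

Section Dot.
Local Open Scope ring_scope.
Variable F : finFieldType.

Definition dot n (u v : 'rV[F]_n) : F := (u *m v^T) 0 0.

Lemma dotE n (u v : 'rV[F]_n) : dot u v = \sum_i u 0 i * v 0 i.
Proof. by rewrite /dot mxE; apply: eq_bigr => i _; rewrite mxE. Qed.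

Lemma dot0l n (v : 'rV[F]_n) : dot 0 v = 0.
Proof. by rewrite /dot mul0mx mxE. Qed.

Lemma dot0r n (u : 'rV[F]_n) : dot u 0 = 0.
Proof. by rewrite /dot trmx0 mulmx0 mxE. Qed.

Lemma dotDl n (u v w : 'rV[F]_n) : dot (u + v) w = dot u w + dot v w.
Proof. by rewrite /dot mulmxDl mxE. Qed.

Lemma dotDr n (u v w : 'rV[F]_n) : dot u (v + w) = dot u v + dot u w.
Proof. by rewrite /dot linearD mulmxDr mxE. Qed.

Lemma dotZr n (u v : 'rV[F]_n) a : dot u (a *: v) = a * dot u v.
Proof. by rewrite /dot linearZ /= -scalemxAr mxE. Qed.

Lemma dot_row_mx n p (a x : 'rV[F]_n) (b y : 'rV[F]_p) :
  dot (row_mx a b) (row_mx x y) = dot a x + dot b y.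
Proof. by rewrite /dot tr_row_mx mul_row_col mxE. Qed.

Lemma dot_delta n (u : 'rV[F]_n) i : dot u (delta_mx 0 i) = u 0 i.
Proof.
rewrite dotE (bigD1 i) //= big1 ?mxE ?eqxx ?mulr1 ?addr0 // => k ki.
by rewrite mxE (negPf ki) andbF mulr0.
Qed.

(* Translation by multiples of [e] permutes the fibres of [dot u] on [X]. *)
Lemma card_dot_neq0 n (X : {set 'rV[F]_n}) (u e : 'rV[F]_n) :
  dot u e = 1 -> (forall t x, x \in X -> x + t *: e \in X) ->
  (#|F| * #|[set x in X | dot u x != 0%R]| = (#|F| - 1) * #|X|)%N.
Proof.
move=> ue stX.
have h0 : #|X| = (#|F| * #|[set x in X | dot u x == 0%R]|)%N.
  rewrite -cardsT -cardsX -(@card_in_imset _ _ (fun p => p.2 + p.1 *: e)).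
    apply: eq_card => x; apply/idP/imsetP => [xX|[[t y]]]; last first.
      by rewrite !inE /= => /andP[yX _] ->; apply: stX.
    exists (dot u x, x - dot u x *: e); last by rewrite /= subrK.
    rewrite !inE /= -scaleNr stX //= dotDr dotZr ue mulr1 subrr eqxx //.
  move=> [t x] [t' x']; rewrite !inE /= => /andP[_ /eqP x0] /andP[_ /eqP x0'] E.
  have := congr1 (dot u) E; rewrite !dotDr !dotZr ue !mulr1 x0 x0' !add0r => tt.
  by move: E; rewrite tt => /addIr ->.
have h1 : (#|X| = #|[set x in X | dot u x == 0%R]| +
                  #|[set x in X | dot u x != 0%R]|)%N.
  rewrite -(cardsID [set x | dot u x == 0%R]); congr (_ + _)%N;
    by apply: eq_card => x; rewrite !inE // andbC.
nia.
Qed.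

Lemma wt_eq0 n (c : 'rV[F]_n) : (wt c == 0)%N = (c == 0).
Proof.
rewrite cards_eq0; apply/eqP/eqP => [E|->].
  apply/rowP => i; have := in_set0 i; rewrite -E inE mxE.
  by move/negbT; rewrite negbK => /eqP.
by apply/setP => i; rewrite !inE mxE eqxx.
Qed.

Lemma delta_mx_neq0 n (i : 'I_n) : delta_mx 0 i != 0 :> 'rV[F]_n.
Proof. by apply/eqP => /rowP/(_ i)/eqP; rewrite !mxE !eqxx oner_eq0. Qed.

End Dot.

Arguments delta_mx_neq0 {F n}.

(** * Coordinate subspaces and their hyperplane sections *)

Section Delta.
Local Open Scope ring_scope.
Variable F : finFieldType.
Variable m : nat.
Implicit Types (P : {set 'I_m}) (v w : 'rV[F]_m).

Lemma inDeltaP P v : reflect (forall i, i \notin P -> v 0 i = 0) (inDelta P v).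
Proof.
apply: (iffP forallP) => h i; first by apply: contraNeq => /(implyP (h i)).
by apply/implyP; apply: contraNT => /h ->.
Qed.

Lemma inDelta0 P : inDelta P (0 : 'rV[F]_m).
Proof. by apply/inDeltaP => i _; rewrite mxE. Qed.

Lemma inDeltaD P v w : inDelta P v -> inDelta P w -> inDelta P (v + w).
Proof.
move=> /inDeltaP hv /inDeltaP hw; apply/inDeltaP => i iP.
by rewrite mxE hv ?hw ?addr0.
Qed.

Lemma inDeltaZ P a v : inDelta P v -> inDelta P (a *: v).
Proof. by move=> /inDeltaP hv; apply/inDeltaP => i iP; rewrite mxE hv ?mulr0. Qed.

Lemma inDeltaB P v w : inDelta P v -> inDelta P w -> inDelta P (v - w).
Proof. by move=> hv hw; rewrite -scaleN1r inDeltaD ?inDeltaZ. Qed.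

Lemma inDeltaS P P' v : P \subset P' -> inDelta P v -> inDelta P' v.
Proof.
move=> /subsetP sP /inDeltaP hv; apply/inDeltaP => i iP'.
by apply: hv; apply: contraNN iP' => /sP.
Qed.

Lemma inDelta_scale P a v : a != 0 -> inDelta P (a *: v) = inDelta P v.
Proof.
move=> a0; apply/idP/idP; last exact: inDeltaZ.
by move/(inDeltaZ a^-1); rewrite scalerK.
Qed.

Lemma inDelta_delta P i : inDelta P (delta_mx 0 i : 'rV[F]_m) = (i \in P).
Proof.
apply/inDeltaP/idP => [h|iP k kP].
  by apply: contraT => /h /eqP; rewrite mxE !eqxx oner_eq0.
by rewrite mxE; case: (k =P i) kP => [->|]; rewrite ?iP // andbF.
Qed.

Lemma dot_inDelta P v w : inDelta (~: P) v -> inDelta P w -> dot v w = 0.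
Proof.
move=> /inDeltaP hv /inDeltaP hw; rewrite dotE big1 // => i _.
case: (boolP (i \in P)) => iP; last by rewrite hw ?mulr0.
by rewrite hv ?mul0r // inE iP.
Qed.

(** A rescaled unit vector at a coordinate of [P] where [v] is nonzero. It serves as translation
    direction in [card_dot_neq0]. *)
Lemma dot_eq1 P v : ~~ inDelta (~: P) v -> exists2 e, inDelta P e & dot v e = 1.
Proof.
rewrite negb_forall => /existsP[i]; rewrite negb_imply inE negbK => /andP[vi iP].
exists ((v 0 i)^-1 *: delta_mx 0 i); first by rewrite inDeltaZ ?inDelta_delta.
by rewrite dotZr dot_delta mulVf.
Qed.

Lemma inDelta_set0 v : inDelta set0 v = (v == 0).
Proof.
apply/idP/eqP => [/inDeltaP h|->]; last exact: inDelta0.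
by apply/rowP => i; rewrite h ?mxE // inE.
Qed.

Lemma inDelta_setT v : inDelta [set: 'I_m] v.
Proof. by apply/inDeltaP => i; rewrite inE. Qed.

Lemma card_inDelta P : #|[set v : 'rV[F]_m | inDelta P v]| = (#|F| ^ #|P|)%N.
Proof.
transitivity #|pffun_on (0 : F) (mem P) (mem [set: F])|; last first.
  by rewrite card_pffun_on cardsT.
rewrite -(@card_in_imset _ _ (fun v : 'rV[F]_m => [ffun i => v 0 i])).
  apply: eq_card => f; apply/imsetP/pffun_onP => [[v]|[/supportP fP _]].
    rewrite inE => /inDeltaP hv ->; split; last by move=> *; rewrite inE.
    by apply/supportP => i iP; rewrite ffunE hv.
  exists (\row_i f i); last by apply/ffunP => i; rewrite ffunE mxE.
  by rewrite inE; apply/inDeltaP => i iP; rewrite mxE fP.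
move=> v w _ _ /ffunP E; apply/rowP => i.
by have := E i; rewrite !ffunE.
Qed.

(** Either [dot v] vanishes on the whole coordinate subspace, or it takes every value equally often
    there. *)
Lemma card_dot_Delta P v :
  (#|F| * #|[set w in [set w | inDelta P w] | dot v w != 0%R]| =
     (#|F| - 1) * (~~ inDelta (~: P) v * #|F| ^ #|P|))%N.
Proof.
case: (boolP (inDelta _ _)) => hv /=; last first.
  have [e eP ve] := dot_eq1 hv.
  rewrite (card_dot_neq0 ve) ?card_inDelta ?mul1n // => t x.
  by rewrite !inE => xP; rewrite inDeltaD ?inDeltaZ.
rewrite (_ : [set w in _ | _] = set0) ?cards0 ?muln0 //.
apply/setP => w; rewrite !inE; apply/negP => /andP[wP].
by rewrite (dot_inDelta hv wP) eqxx.
Qed.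

(** This is [q / (q - 1)] times the number of [w] outside the subspace of [P] with [dot v w]
    nonzero. The subtraction never truncates: a [v] outside [inDelta (~: P)] is nonzero, and [P] has
    at most [m] elements. *)
Definition zone_weight P v : nat :=
  (((v != 0%R) * #|F| ^ m) - (~~ inDelta (~: P) v * #|F| ^ #|P|))%N.

(** The count on the full space, which is the case [P = setT] of [card_dot_Delta], minus the count
    on the subspace. *)
Lemma card_dot_DeltaC P v :
  (#|F| * #|[set w | ~~ inDelta P w & dot v w != 0%R]| =
     (#|F| - 1) * zone_weight P v)%N.
Proof.
have := card_dot_Delta [set: 'I_m] v; have := card_dot_Delta P v.
rewrite setCT inDelta_set0 cardsT card_ord /zone_weight mulnBr => <- <-.
rewrite -mulnBr; congr (_ * _)%N.
rewrite -[in RHS](cardsID [set w | inDelta P w]).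
set X := _ :&: _; set Y := _ :\: _; set Z := [set w in _ | _].
have -> : X = Z by apply/setP => w; rewrite !inE inDelta_setT andbC.
rewrite addKn; apply: eq_card => w.
by rewrite !inE inDelta_setT.
Qed.

End Delta.

(** * Matrices whose columns represent the scalar classes of a set *)

Lemma count_ord (T : Type) (x0 : T) (p : pred T) (s : seq T) :
  count p s = #|[set j : 'I_(size s) | p (nth x0 s j)]|.
Proof.
rewrite -sum1_count (big_nth x0) big_mkord -sum1_card.
by apply: eq_bigl => j; rewrite inE.
Qed.

Section RepSystem.
Local Open Scope ring_scope.
Variable F : finFieldType.
Variables (n : nat) (S : {set 'rV[F]_n}) (s : seq 'rV[F]_n).
Hypothesis repS : is_rep_system S s.
Hypothesis S0 : 0 \notin S.
Hypothesis SZ : forall (a : F) x, a != 0 -> x \in S -> a *: x \in S.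

Let prop (x y : 'rV[F]_n) := [exists a : F, (a != 0) && (y == a *: x)].

Lemma rep_mem (j : 'I_(size s)) : s`_j \in S.
Proof. by apply: repS.1; apply: mem_nth. Qed.

Lemma rep_exists x : x \in S ->
  exists l : 'I_(size s), exists2 a : F, a != 0 & s`_l = a *: x.
Proof.
move=> /repS.2; rewrite (count_ord 0) => /eqP/cards1P[l E].
have : l \in [set l] by rewrite inE.
rewrite -E inE => /existsP[a /andP[a0 /eqP El]].
by exists l, a.
Qed.

(** Both indices are counted in the class of column [j], where the count is one. Hence distinct
    columns are never proportional. *)
Lemma rep_inj (j l : 'I_(size s)) a : a != 0 -> s`_l = a *: s`_j -> l = j.
Proof.
move=> a0 El; have /eqP := repS.2 _ (rep_mem j).
rewrite (count_ord 0) => /eqP/eq_leq/card_le1_eqP le1.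
apply: le1; rewrite inE; apply/existsP.
  by exists 1; rewrite oner_eq0 scale1r eqxx.
by exists a; rewrite a0 El eqxx.
Qed.

(** Double counting of the pairs [(x, j)] with column [j] proportional to [x]: each [x] has one such
    column, and each column has [q - 1] such [x]. *)
Lemma card_rep (P : pred 'rV[F]_n) :
  (forall a x, a != 0 -> P (a *: x) = P x) ->
  #|[set x in S | P x]| = ((#|F| - 1) * #|[set j : 'I_(size s) | P (s`_j)%R]|)%N.
Proof.
move=> PZ; rewrite -sum1_card.
transitivity (\sum_(x in [set x in S | P x])
                \sum_(j < size s | prop x (s`_j)%R) 1)%N.
  apply: eq_bigr => x; rewrite inE => /andP[xS _].
  transitivity (count (prop x) s); first by rewrite repS.2.
  rewrite (count_ord 0) -sum1_card.
  by apply: eq_bigl => j; rewrite inE.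
rewrite (exchange_big_dep (fun j : 'I_(size s) => P s`_j)) /=; last first.
  move=> x j; rewrite inE => /andP[_ Px] /existsP[a /andP[a0 /eqP ->]].
  by rewrite PZ.
(* Since column [j] is nonzero, its multiples by the nonzero scalars are pairwise distinct. *)
rewrite (eq_bigr (fun=> (#|F| - 1)%N)); last first.
  move=> j Pj; rewrite sum1dep_card subn1 -(cardsC1 (0 : F)).
  have j0 : s`_j != 0 by apply: contraNneq S0 => <-; exact: rep_mem.
  rewrite -(@card_in_imset _ _ (fun a => a *: s`_j)); last first.
    move=> a b _ _ /eqP; rewrite -subr_eq0 -scalerBl scaler_eq0 (negPf j0) orbF.
    by rewrite subr_eq0 => /eqP.
  apply: eq_card => x; rewrite !inE; apply/andP/imsetP.
    case=> _ /existsP[a /andP[a0 /eqP ->]].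
    by exists a^-1; rewrite ?inE ?invr_eq0 // scalerK.
  case=> a; rewrite !inE => a0 ->; split; first by rewrite SZ ?rep_mem ?PZ.
  by apply/existsP; exists a^-1; rewrite invr_eq0 a0 scalerK ?eqxx.
by rewrite sum_nat_const mulnC; congr (_ * _)%N; apply: eq_card => j; rewrite inE.
Qed.

Lemma size_rep : ((size s) * (#|F| - 1) = #|S|)%N.
Proof.
have := @card_rep predT (fun _ _ _ => erefl).
have -> : [set j : 'I_(size s) | predT s`_j] = setT by apply/setP => j; rewrite !inE.
rewrite cardsT card_ord mulnC => <-.
by apply: eq_card => x; rewrite !inE andbT.
Qed.

Lemma Nbar_genmxE (u : 'rV[F]_n) j : (u *m Nbar_genmx s) 0 j = dot u s`_j.
Proof. by rewrite dotE mxE; apply: eq_bigr => i _; rewrite mxE. Qed.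

Lemma card_nonzero_codeword (u : 'rV[F]_n) :
  #|[set x in S | dot u x != 0%R]| = ((#|F| - 1) * wt (u *m Nbar_genmx s))%N.
Proof.
rewrite (@card_rep (fun x => dot u x != 0)) => [|a x a0]; last first.
  by rewrite dotZr mulf_eq0 (negPf a0).
by congr (_ * _)%N; apply: eq_card => j; rewrite !inE Nbar_genmxE.
Qed.

Lemma col_Nbar_eq (j : 'I_(size s)) (T : {set 'I_(size s)}) (a : 'I_(size s) -> F) :
  col j (Nbar_genmx s) = \sum_(l in T) a l *: col l (Nbar_genmx s) <->
  s`_j = \sum_(l in T) a l *: s`_l.
Proof.
split=> E.
  apply/rowP => i; have /colP/(_ i) := E; rewrite !mxE !summxE => ->.
  by apply: eq_bigr => l _; rewrite !mxE.
apply/colP => i; rewrite !mxE {}E !summxE.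
by apply: eq_bigr => l _; rewrite !mxE.
Qed.

(** An empty repair set would make the column zero, and a singleton would make two distinct columns
    proportional. *)
Lemma not_col_repairable1 (j : 'I_(size s)) : ~ col_repairable (Nbar_genmx s) j 1.
Proof.
case=> T [a [jT [T1 /col_Nbar_eq E]]].
have j0 : s`_j != 0 by apply: contraNneq S0 => <-; exact: rep_mem.
have /cards1P[l Tl] : #|T| == 1%N.
  rewrite eqn_leq T1 card_gt0; apply: contraNneq j0 => T0.
  by rewrite E T0 big_set0.
move: E jT; rewrite Tl big_set1 inE => E; case/eqP.
apply: (rep_inj _ E); apply: contraNneq j0 => a0.
by rewrite E a0 scale0r.
Qed.

(** Allows repair by arbitrary elements of [S], each then replaced by its representative column.
    Non-proportionality keeps [j] itself out of the repair set. *)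
Lemma col_repairable_span (j : 'I_(size s)) k (y : 'I_k -> 'rV[F]_n) (b : 'I_k -> F) :
  (forall i, y i \in S) -> (forall i a, a != 0 -> s`_j != a *: y i) ->
  s`_j = \sum_i b i *: y i -> col_repairable (Nbar_genmx s) j k.
Proof.
move=> yS yj E.
have /fin_all_exists[g hg] : forall i, exists l : 'I_(size s),
    exists2 a : F, a != 0 & s`_l = a *: y i by move=> i; apply: rep_exists.
have /fin_all_exists2[c c0 hc] := hg.
(* Several [y i] may share a representative; their rescaled coefficients are then added, and the
   repair set has fewer than [k] elements. *)
exists (g @: 'I_k), (fun l => \sum_(i | g i == l) b i * (c i)^-1); split.
  apply/imsetP => -[i _ ji]; move: (yj i _ (c0 i)).
  by rewrite -hc ji eqxx.
split; first by rewrite -[leqRHS]card_ord leq_imset_card.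
apply/col_Nbar_eq; rewrite E (partition_big_imset g).
apply: eq_big => [l|l _]; first by rewrite ?inE.
rewrite scaler_suml; apply: eq_big => [i|i /andP[_ /eqP <-]]; first by rewrite ?inE.
by rewrite hc scalerA divfK.
Qed.
End RepSystem.

(** * Parametrization, cardinality and symmetries of [N2] *)

Section N2.
Local Open Scope ring_scope.
Variables (F : finFieldType) (m : nat).
Variables (A B C : {set 'I_m}).
Hypothesis B0 : B != set0.
Hypothesis sBA : B \subset A.
Hypothesis pA : A \proper [set: 'I_m].
Local Notation q := #|F|.

Definition N2vec (p : (bool * 'rV[F]_m) * ('rV[F]_m * 'rV[F]_m)) : 'rV[F]_(m + m + m) :=
  row_mx (row_mx (p.2.1 + (if p.1.1 then p.1.2 else 0)) p.2.2) p.1.2.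

Definition N2dom : {set (bool * 'rV[F]_m) * ('rV[F]_m * 'rV[F]_m)} :=
  setX [set z | ~~ inDelta A z.2]
    (setX [set v | inDelta B v] [set v | inDelta C v]).

Lemma N2_imset : N2 A B C = N2vec @: N2dom.
Proof.
apply/setP => x; rewrite inE; apply/idP/imsetP.
  case/existsP=> w1 /existsP[w2 /existsP[w3 /existsP[om]]] /and4P[h1 h2 h3 /eqP ->].
  by exists ((om, w1), (w2, w3)); rewrite ?inE /= ?h1 ?h2.
case=> -[[om w1] [w2 w3]]; rewrite !inE /= => /and3P[h1 h2 h3] ->.
apply/existsP; exists w1; apply/existsP; exists w2; apply/existsP; exists w3.
by apply/existsP; exists om; rewrite h1 h2 h3 eqxx.
Qed.

(* [w1] is nonzero outside [A], hence outside [B], so the two values of the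
   flag give disjoint families. *)
Lemma N2vec_inj : {in N2dom &, injective N2vec}.
Proof.
move=> [[om w1] [w2 w3]] [[om' w1'] [w2' w3']].
rewrite !inE /= => /and3P[h1 h2 _] /and3P[_ h2' _].
move=> /eq_row_mx[/eq_row_mx[/= E ->] E1]; rewrite -{}E1 {w1'} in E *.
have hB : ~~ inDelta B w1 by apply: contra h1; exact: inDeltaS.
case: om om' E => [] [] /= E.
- by rewrite (addIr _ E).
- by case/negP: hB; rewrite addr0 in E; rewrite -[w1](addKr w2) E addrC inDeltaB.
- by case/negP: hB; rewrite addr0 in E; rewrite -[w1](addKr w2') -E addrC inDeltaB.
- by rewrite !addr0 in E; rewrite E.
Qed.

(** When membership depends only on the flag and [w1], the free choices of [w2] and [w3] contribute
    the power of [q], and the two flag values give disjoint families. *)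
Lemma card_N2_sub (P : bool -> pred 'rV[F]_m) (Q : pred 'rV[F]_(m + m + m)) :
  (forall p, p \in N2dom -> Q (N2vec p) = P p.1.1 p.1.2) ->
  #|[set x in N2 A B C | Q x]| =
    ((#|[set w | ~~ inDelta A w & P false w]| + #|[set w | ~~ inDelta A w & P true w]|)
      * q ^ (#|B| + #|C|))%N.
Proof.
move=> hQ.
have -> : [set x in N2 A B C | Q x] = N2vec @: [set p in N2dom | P p.1.1 p.1.2].
  rewrite N2_imset; apply/setP => x; rewrite inE; apply/andP/imsetP.
    by case=> /imsetP[p pD ->]; rewrite hQ // => Pp; exists p; rewrite // inE pD.
  case=> p; rewrite inE => /andP[pD Pp] ->; split; first exact: imset_f.
  by rewrite hQ.
rewrite card_in_imset; last first.
  by move=> x y /setIdP[xD _] /setIdP[yD _]; apply: N2vec_inj.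
have -> : [set p in N2dom | P p.1.1 p.1.2] =
    setX ((setX [set false] [set w | ~~ inDelta A w & P false w]) :|:
          (setX [set true] [set w | ~~ inDelta A w & P true w]))
      (setX [set v | inDelta B v] [set v | inDelta C v]).
  apply/setP => -[[om w1] [w2 w3]]; rewrite !inE /=.
  by case: om => /=; rewrite ?orbF; case: (P _ w1); rewrite ?andbT ?andbF.
rewrite !cardsX !card_inDelta expnD; congr (_ * _)%N.
rewrite cardsU !cardsX !cards1 !mul1n (_ : _ :&: _ = set0) ?cards0 ?subn0 //.
by apply/setP => -[[] w]; rewrite !inE /= ?andbF.
Qed.

Lemma card_inDeltaC : #|[set w : 'rV[F]_m | ~~ inDelta A w]| = (q ^ m - q ^ #|A|)%N.
Proof.
rewrite -card_inDelta; have := cardsC [set w : 'rV[F]_m | inDelta A w].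
rewrite card_mx mul1n => <-; rewrite addKn; apply: eq_card => w.
by rewrite !inE.
Qed.

Lemma card_N2 :
  #|@N2 F m A B C| = (2 * q ^ (#|B| + #|C|) * (q ^ m - q ^ #|A|))%N.
Proof.
have := @card_N2_sub (fun _ => predT) predT (fun _ _ => erefl).
have E : [set w : 'rV[F]_m | ~~ inDelta A w & predT w] = [set w | ~~ inDelta A w].
  by apply/setP => w; rewrite !inE andbT.
have E' : [set x in @N2 F m A B C | predT x] = N2 A B C.
  by apply/setP => w; rewrite !inE andbT.
by rewrite E E' card_inDeltaC => ->; rewrite addnn -mul2n mulnAC.
Qed.

Lemma N2_neq0 : 0 \notin @N2 F m A B C.
Proof.
rewrite N2_imset; apply/imsetP => -[[[om w1] [w2 w3]]].
rewrite !inE /= => /and3P[h1 _ _] E; case/negP: h1.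
have := congr1 rsubmx E; rewrite linear0 row_mxKr /= => <-.
exact: inDelta0.
Qed.

Lemma N2_scale (a : F) x : a != 0 -> x \in @N2 F m A B C -> a *: x \in @N2 F m A B C.
Proof.
rewrite N2_imset => a0 /imsetP[[[om w1] [w2 w3]] hp ->].
apply/imsetP; exists ((om, a *: w1), (a *: w2, a *: w3)).
  by move: hp; rewrite !inE /= !inDelta_scale.
by rewrite /N2vec /= !scale_row_mx scalerDr; case: om {hp}; rewrite ?scaler0.
Qed.

Lemma dot_N2vec (a b c w1 w2 w3 : 'rV[F]_m) om :
  dot (row_mx (row_mx a b) c) (N2vec ((om, w1), (w2, w3))) =
  dot a w2 + dot b w3 + dot ((if om then a else 0) + c) w1.
Proof.
rewrite /N2vec /= !dot_row_mx dotDr dotDl !addrA; congr (_ + _).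
by case: om; rewrite ?dot0l ?dot0r ?addr0 // addrAC.
Qed.

Lemma N2vec_shift om (w1 w2 w3 v t : 'rV[F]_m) :
  N2vec ((om, w1), (w2 + v, w3 + t)) =
  N2vec ((om, w1), (w2, w3)) + row_mx (row_mx v t) 0.
Proof. by rewrite /N2vec /= !add_row_mx addr0 addrAC. Qed.

(** This invariance yields both the equidistribution of codeword values and most of the repair
    sets. *)
Lemma N2_shift x (v t : 'rV[F]_m) : x \in @N2 F m A B C ->
  inDelta B v -> inDelta C t -> x + row_mx (row_mx v t) 0 \in @N2 F m A B C.
Proof.
rewrite N2_imset => /imsetP[[[om w1] [w2 w3]] hp ->] hv ht.
apply/imsetP; exists ((om, w1), (w2 + v, w3 + t)); last by rewrite N2vec_shift.
by move: hp; rewrite !inE /= => /and3P[-> h2 h3]; rewrite !inDeltaD.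
Qed.

(** * Weights of the codewords *)

Variable s : seq 'rV[F]_(m + m + m).
Hypothesis repS : is_rep_system (N2 A B C) s.

Lemma card_F_gt1 : (1 < q)%N.
Proof. exact: finNzRing_gt1. Qed.

Lemma wt_N2codeword (a b c : 'rV[F]_m) :
  wt (row_mx (row_mx a b) c *m Nbar_genmx s) =
  ((if inDelta (~: B) a && inDelta (~: C) b
    then zone_weight A c + zone_weight A (a + c) else 2 * (q ^ m - q ^ #|A|))
   * q ^ (#|B| + #|C| - 1))%N.
Proof.
have q1 := card_F_gt1.
have E := card_nonzero_codeword repS N2_neq0 N2_scale (row_mx (row_mx a b) c).
set W := wt _ in E *; set N := #|_| in E.
(* Multiplying the weight formula by [q * (q - 1)] avoids all divisions; both factors are positive
   and cancel. *)
suff : (q * N = (q - 1) * (q * ((if inDelta (~: B) a && inDelta (~: C) b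
    then zone_weight A c + zone_weight A (a + c) else 2 * (q ^ m - q ^ #|A|))
   * q ^ (#|B| + #|C| - 1))))%N.
  rewrite E [(q * _)%N]mulnCA => /eqP; rewrite eqn_pmul2l ?subn_gt0 //.
  by rewrite eqn_pmul2l; [move/eqP | lia].
(* The exponent [#|B| + #|C| - 1] does not truncate because [B] is nonempty. *)
have qE : (q ^ (#|B| + #|C|) = q * q ^ (#|B| + #|C| - 1))%N.
  by rewrite -expnS; congr expn; move: B0; rewrite -card_gt0; lia.
case: ifP => [/andP[ha hb]|/negbT].
  (* Here [w2] and [w3] contribute nothing to the scalar product, and the two flags leave [c] and
     [a + c] acting on [w1]. *)
  rewrite /N (@card_N2_sub (fun om w => dot ((if om then a else 0) + c) w != 0)).
    rewrite add0r mulnA mulnDr !card_dot_DeltaC -mulnDr qE.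
    by rewrite -mulnA; congr (_ * _)%N; rewrite mulnCA.
  case=> -[om w1] [w2 w3]; rewrite !inE /= => /and3P[_ h2 h3].
  by rewrite dot_N2vec (dot_inDelta ha h2) (dot_inDelta hb h3) !add0r.
(* Translation by [(e1, e2, 0)] preserves [N2] and raises the value of the functional by 1, so all
   values are equally frequent. *)
have key e1 e2 : inDelta B e1 -> inDelta C e2 -> dot a e1 + dot b e2 = 1 ->
    (q * N = (q - 1) * (q * (2 * (q ^ m - q ^ #|A|) * q ^ (#|B| + #|C| - 1))))%N.
  move=> h1 h2 h3; rewrite /N (@card_dot_neq0 _ _ _ _ (row_mx (row_mx e1 e2) 0)).
  - by rewrite card_N2 qE; congr (_ * _)%N; rewrite mulnAC mulnCA.
  - by rewrite !dot_row_mx dot0r addr0.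
  by move=> t x xN; rewrite !scale_row_mx scaler0 N2_shift ?inDeltaZ.
rewrite negb_and => /orP[/dot_eq1[e he1 he2]|/dot_eq1[e he1 he2]].
  by apply: (key e 0); rewrite ?inDelta0 // dot0r addr0.
by apply: (key 0 e); rewrite ?inDelta0 // dot0r add0r.
Qed.

(** * Zero codewords, dimension and minimum distance *)

Lemma exp_A_bound : (2 * q ^ #|A| <= q ^ m)%N.
Proof.
have : (q * q ^ #|A| <= q ^ m)%N.
  rewrite -expnS leq_exp2l ?card_F_gt1 //.
  by have := proper_card pA; rewrite cardsT card_ord.
by apply: leq_trans; rewrite leq_mul2r card_F_gt1 orbT.
Qed.

Lemma exp_A_gt0 : (0 < q ^ #|A|)%N.
Proof. by rewrite expn_gt0 (ltnW card_F_gt1). Qed.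

Lemma exp_A_lt : (q ^ #|A| < q ^ m)%N.
Proof. have := exp_A_bound; have := exp_A_gt0; lia. Qed.

Lemma zone_weight0 : zone_weight A (0 : 'rV[F]_m) = 0%N.
Proof. by rewrite /zone_weight eqxx. Qed.

Lemma zone_weight_full (v : 'rV[F]_m) :
  v != 0 -> inDelta (~: A) v -> zone_weight A v = (q ^ m)%N.
Proof. by rewrite /zone_weight => -> ->; rewrite mul1n subn0. Qed.

Lemma zone_weight_ge (v : 'rV[F]_m) :
  v != 0 -> (q ^ m - q ^ #|A| <= zone_weight A v)%N.
Proof.
by rewrite /zone_weight => ->; rewrite mul1n leq_sub2l //; case: (~~ _); rewrite ?mul1n.
Qed.

Lemma zone_weight_eq0 (v : 'rV[F]_m) : (zone_weight A v == 0)%N = (v == 0).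
Proof.
apply/idP/eqP => [|->]; last by rewrite zone_weight0.
apply: contraTeq => /zone_weight_ge; have := exp_A_bound; have := exp_A_gt0; lia.
Qed.

(** In the equidistributed case the weight is positive because [q ^ #|A| < q ^ m]. Otherwise both
    zone weights must vanish, which forces [c = 0] and then [a = 0]. *)
Lemma N2codeword_eq0 (a b c : 'rV[F]_m) :
  (row_mx (row_mx a b) c *m Nbar_genmx s == 0) =
  [&& a == 0, inDelta (~: C) b & c == 0].
Proof.
rewrite -[LHS]wt_eq0 wt_N2codeword muln_eq0 orbC expn_eq0 eqn0Ngt.
rewrite (ltnW card_F_gt1) /=; case: ifP => [/andP[ha ->]|/negbT h].
  rewrite addn_eq0 !zone_weight_eq0 /= andbC; apply: andb_id2r => /eqP ->.
  by rewrite addr0.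
rewrite muln_eq0 /= subn_eq0 leqNgt exp_A_lt /=.
apply/esym/negP => /and3P[/eqP a0 hb _]; case/negP: h.
by rewrite a0 inDelta0.
Qed.

(** The left kernel consists of the [(0, b, 0)] with [b] vanishing on [C], so it has dimension
    [m - #|C|], to be subtracted from [3 * m]. *)
Lemma rank_N2 : \rank (Nbar_genmx s) = (2 * m + #|C|)%N.
Proof.
set G := Nbar_genmx s.
have /eqP : (q ^ \rank (kermx G) = q ^ #|~: C|)%N.
  rewrite -card_rowg -card_inDelta.
  have f_inj : injective (fun b : 'rV[F]_m => row_mx (row_mx (0 : 'rV_m) b) (0 : 'rV_m)).
    by move=> b b' /eq_row_mx[/eq_row_mx[]].
  rewrite -(card_imset _ f_inj).
  apply: eq_card => u; rewrite inE; apply/sub_kermxP/imsetP => [/eqP|[b]].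
    rewrite -[u]hsubmxK -[lsubmx u]hsubmxK N2codeword_eq0.
    case/and3P=> /eqP -> hb /eqP ->.
    by exists (rsubmx (lsubmx u)); rewrite ?inE.
  by rewrite inE => hb ->; apply/eqP; rewrite N2codeword_eq0 !eqxx hb.
(* The kernel dimension is a truncated subtraction; [rank_leq_row] makes it exact. *)
rewrite eqn_exp2l ?card_F_gt1 // mxrank_ker => /eqP.
have := cardsC C; rewrite card_ord; have := rank_leq_row G; lia.
Qed.

Lemma min_dist_N2 : min_dist (Nbar_genmx s)
  ((q ^ m - (if B == A then 0 else 1) * q ^ #|A|) * q ^ (#|B| + #|C| - 1))%N.
Proof.
have bnd := exp_A_bound; have Agt0 := exp_A_gt0.
split.
  (* The minimum is attained at [(e_i, 0, 0)]: with [i] outside [A] its zone weight is [q ^ m], with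
     [i] in [A] but not in [B] it is [q ^ m - q ^ #|A|]. *)
  have [i iB iA] : exists2 i, i \notin B & (i \in A) = (B != A).
    have [->|BA] := eqVneq B A.
      by have [_ [i _ iA]] := properP pA; exists i => //; apply: negbTE.
    have /properP[_ [i iA iB]] : B \proper A by rewrite properEneq BA.
    by exists i.
  pose a : 'rV[F]_m := delta_mx 0 i.
  have a0 : a != 0 := delta_mx_neq0 i.
  have wta : wt (row_mx (row_mx a 0) 0 *m Nbar_genmx s) =
    ((q ^ m - (if B == A then 0 else 1) * q ^ #|A|) * q ^ (#|B| + #|C| - 1))%N.
    rewrite wt_N2codeword inDelta0 inDelta_delta inE iB /= zone_weight0 addr0 add0n.
    congr (_ * _)%N; rewrite /zone_weight a0 mul1n inDelta_delta inE iA.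
    by rewrite negbK; case: (B == A).
  exists (row_mx (row_mx a 0) 0 *m Nbar_genmx s); split; first by eexists.
  by split=> //; rewrite N2codeword_eq0 (negPf a0).
have [M [N [EM EN]]] : exists M N, M = (q ^ m)%N /\ N = (q ^ #|A|)%N.
  by exists (q ^ m)%N, (q ^ #|A|)%N.
have zge (v : 'rV[F]_m) : v != 0 -> (M - N <= zone_weight A v)%N.
  by rewrite EM EN; apply: zone_weight_ge.
have zfull (v : 'rV[F]_m) : v != 0 -> inDelta (~: A) v -> zone_weight A v = M.
  by rewrite EM; apply: zone_weight_full.
rewrite -EM -EN in bnd Agt0 *.
move=> _ [u ->]; rewrite -wt_eq0 -[u]hsubmxK -[lsubmx u]hsubmxK.
move: (lsubmx (lsubmx u)) (rsubmx (lsubmx u)) (rsubmx u) => a b c.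
rewrite wt_N2codeword muln_eq0 negb_or => /andP[+ _].
(* In the equidistributed case [2 * (M - N) >= M] follows from [2 * N <= M]. *)
rewrite leq_mul2r -EM -EN; case: ifP => [/andP[ha _]|_ _]; last first.
  by apply/orP; right; case: (B == A); lia.
rewrite addn_eq0 !zone_weight_eq0 => h; apply/orP; right.
(* If [B] differs from [A], one nonzero vector among [c] and [a + c] already gives [M - N]. *)
have [BA|_] := eqVneq B A; last first.
  have [c0|/zge] := eqVneq c 0; last by lia.
  by move: h; rewrite c0 eqxx addr0 => /zge; lia.
(* If [B = A], then [a] vanishes on [A]. When one of [c] and [a + c] is zero, the other is [a] or
   [- a] and has full weight [M]; when neither is, two terms of at least [M - N] suffice. *)
rewrite BA in ha; have [c0|c0] := eqVneq c 0.
  by move: h; rewrite c0 eqxx addr0 => /zfull/(_ ha) ->; lia.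
have [ac0|/zge] := eqVneq (a + c) 0; last by have := zge _ c0; lia.
rewrite (zfull _ c0); first by lia.
by rewrite -[c](addKr a) ac0 addr0 -scaleN1r inDeltaZ.
Qed.

(** * Repair of a column by two others over larger fields *)

Lemma N2_shift_not_prop (d : 'rV[F]_(m + m)) (a : F) x :
  d != 0 -> x \in @N2 F m A B C -> x != a *: (x + row_mx d 0).
Proof.
move=> d0; rewrite N2_imset => /imsetP[[[om w1] [w2 w3]]].
rewrite !inE /= => /and3P[h1 _ _] ->; apply: contraNneq d0 => E.
have w0 : w1 != 0 by apply: contraNneq h1 => ->; exact: inDelta0.
(* The last block [w1] is nonzero and unchanged by the translation, so it determines the factor. *)
have a1 : a = 1.
  have := congr1 rsubmx E; rewrite linearZ linearD /= !row_mxKr addr0 => /eqP.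
  rewrite -subr_eq0 -{1}[w1]scale1r -scalerBl scaler_eq0 (negPf w0) orbF subr_eq0.
  by move=> /eqP.
move: E; rewrite a1 scale1r => /eqP; rewrite eq_sym addrC -subr_eq0 addrK.
by rewrite row_mx_eq0 => /andP[].
Qed.

(* On the affine line [x + F v], the point [x] is an affine combination of
   [x + v] and [x + l v] as soon as [l] is neither [0] nor [1]. *)
Lemma repair2_large j : (2 < q)%N -> col_repairable (Nbar_genmx s) j 2.
Proof.
move=> q3; have [i iB] := set0Pn _ B0.
have [l l0 l1] : exists2 l : F, l != 0 & l != 1.
  have /set0Pn[l] : ~: [set 0; 1] != set0 :> {set F}.
    have c2 : #|[set 0; 1 : F]| = 2%N by rewrite cards2 eq_sym oner_eq0.
    by rewrite -card_gt0 -(ltn_add2l 2%N) addn0 -[X in (_ < X + _)%N]c2 cardsC.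
  by rewrite !inE negb_or => /andP[? ?]; exists l.
have l1' : 1 - l != 0 by rewrite subr_eq0 eq_sym.
pose v : 'rV[F]_m := delta_mx 0 i.
pose e (t : F) : 'rV[F]_(m + m) := row_mx (t *: v) 0.
have jN := rep_mem repS j.
(* The coefficients sum to 1, and weighted by the parameters [1] and [l] they sum to 0, so [v]
   cancels. *)
apply: (@col_repairable_span _ _ _ _ repS _ _
  (fun k => s`_j + row_mx (e (if k == ord0 then 1 else l)) 0)
  (fun k => if k == ord0 then - l / (1 - l) else 1 / (1 - l))).
- by move=> k; rewrite N2_shift ?inDelta0 ?inDeltaZ ?inDelta_delta.
- move=> k a _; apply: N2_shift_not_prop => //.
  rewrite row_mx_eq0 eqxx andbT scaler_eq0 (negPf (delta_mx_neq0 _)) orbF.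
  by case: ifP; rewrite ?oner_eq0.
rewrite !big_ord_recl big_ord0 /= addr0 !scalerDr addrACA -scalerDl.
rewrite -mulrDl [- l + 1]addrC divff // scale1r /e !scale_row_mx !add_row_mx !scaler0 !addr0.
rewrite !scalerA -scalerDl mulr1 mul1r mulNr [l / _]mulrC addNr scale0r.
by rewrite !row_mx0 addr0.
Qed.

(** * Repair over the binary field *)

Section Binary.
Hypothesis q2 : q = 2%N.

Lemma F2_neq0 (a : F) : a != 0 -> a = 1.
Proof.
move=> a0; have /eqP E : [set 0; 1 : F] == setT.
  by rewrite eqEcard subsetT cardsT q2 cards2 eq_sym oner_eq0.
have : a \in [set 0; 1 : F] by rewrite E inE.
by rewrite !inE (negPf a0) => /eqP.
Qed.

Lemma F2_addrr n (v : 'rV[F]_n) : v + v = 0.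
Proof.
have : (1 + 1 : F) = 0.
  apply/eqP; apply: contraT => /F2_neq0 /eqP.
  by rewrite -subr_eq0 addrK oner_eq0.
by move=> E; rewrite -[v]scale1r -scalerDl E scale0r.
Qed.

Lemma repair2_binary j : (2 <= #|~: A|)%N -> col_repairable (Nbar_genmx s) j 2.
Proof.
move=> cA; have := rep_mem repS j.
rewrite {1}N2_imset => /imsetP[[[om w1] [w2 w3]]]; rewrite !inE /=.
case/and3P=> h1 h2 h3 Ej.
(* Of two coordinates [i] and [k] outside [A], at least one works: otherwise the difference of the
   two vectors, [e_k - e_i], would be supported in [A]. *)
have [i iA hi] : exists2 i, i \notin A & ~~ inDelta A (w1 - delta_mx 0 i).
  have [i [k [iA kA ik]]] : exists i k, [/\ i \in ~: A, k \in ~: A & i != k].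
    by have /card_gt1P[i [k [? ? ?]]] := cA; exists i, k.
  rewrite !inE in iA kA.
  have [hi|] := boolP (inDelta A (w1 - delta_mx 0 i)); last by exists i.
  exists k => //; apply: contra iA => hk.
  have := inDeltaB hi hk; rewrite opprB addrC addrA subrK.
  move/inDeltaP/(_ k kA)/eqP; rewrite !mxE !eqxx [k == i]eq_sym (negPf ik) subr0.
  by rewrite oner_eq0.
(* Both summands keep the flag [om], so the [w1] parts add up in the first block too; [w2] and [w3]
   go entirely to [y1]. *)
pose y0 := N2vec ((om, delta_mx 0 i : 'rV[F]_m), (0, 0)).
pose y1 := N2vec ((om, w1 - delta_mx 0 i), (w2, w3)).
have y0N : y0 \in N2 A B C.
  by rewrite N2_imset imset_f // !inE /= inDelta_delta iA !inDelta0.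
have y1N : y1 \in N2 A B C by rewrite N2_imset imset_f // !inE /= hi h2.
have Ey : s`_j = y0 + y1.
  rewrite Ej /y0 /y1 /N2vec /= !add_row_mx !add0r [delta_mx 0 i + _]addrC subrK.
  by case: (om); rewrite ?add0r // addrCA [delta_mx 0 i + _]addrC subrK.
have y00 : y0 != 0 by apply: contraNneq N2_neq0 => <-.
have y10 : y1 != 0 by apply: contraNneq N2_neq0 => <-.
apply: (@col_repairable_span _ _ _ _ repS _ _
  (fun k => if k == ord0 then y0 else y1) (fun=> 1)).
- by move=> k; case: ifP.
- move=> k a /F2_neq0 ->; rewrite scale1r Ey -subr_eq0.
  by case: ifP => _; rewrite ?addrK // addrAC subrr add0r.
by rewrite !big_ord_recl big_ord0 /= !scale1r addr0.
Qed.

Lemma repair3_binary j : C != set0 -> col_repairable (Nbar_genmx s) j 3.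
Proof.
move=> C0; have [i iB] := set0Pn _ B0; have [k kC] := set0Pn _ C0.
have jN := rep_mem repS j.
pose v (b : bool) : 'rV[F]_m := if b then delta_mx 0 i else 0.
pose t (b : bool) : 'rV[F]_m := if b then delta_mx 0 k else 0.
pose y b b' := s`_j + row_mx (row_mx (v b) (t b')) 0.
(* Indices 0, 1, 2 give [x + v], [x + t] and [x + v + t], where nonempty [B] and [C] provide the
   nonzero [v] and [t]. *)
apply: (@col_repairable_span _ _ _ _ repS _ _
  (fun l : 'I_3 => y (l != 1 :> nat) (l != 0 :> nat)) (fun=> 1)).
- move=> l; rewrite N2_shift // /v /t; case: ifP => _;
    by rewrite ?inDelta0 ?inDelta_delta.
- move=> l a _; apply: N2_shift_not_prop => //; rewrite row_mx_eq0 negb_and.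
  rewrite /v /t; have [->|_] := eqVneq (l : nat) 1%N; rewrite ?delta_mx_neq0 //.
  by rewrite orbT.
rewrite !big_ord_recl big_ord0 /= !scale1r addr0 /y /v /t /=.
rewrite [X in _ + X]addrACA F2_addrr add0r !add_row_mx !add0r F2_addrr.
by rewrite -addrA F2_addrr addr0.
Qed.

(* With a single coordinate outside [A], every column has a [1] there, so only
   sums of an odd number of columns are available. *)
Lemma not_repair2_binary j : #|~: A| = 1%N -> ~ col_repairable (Nbar_genmx s) j 2.
Proof.
move/eqP/cards1P=> [i Ai] [T [a [jT [T2 /col_Nbar_eq E]]]].
have s1 (l : 'I_(size s)) : rsubmx (s`_l) 0 i = 1.
  have := rep_mem repS l; rewrite N2_imset => /imsetP[[[om w1] [w2 w3]]].
  rewrite !inE /= => /and3P[h1 _ _] ->; rewrite row_mxKr; apply: F2_neq0.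
  apply: contra h1 => /eqP wi; apply/inDeltaP => k.
  by rewrite -in_setC Ai inE => /eqP ->.
pose U := [set l in T | a l != 0].
have EU : s`_j = \sum_(l in U) s`_l.
  rewrite E (bigID (fun l => a l == 0)) /= big1 ?add0r => [|l /andP[_ /eqP ->]].
    by apply: eq_big => [l|l /andP[_ /F2_neq0 ->]]; rewrite ?inE ?scale1r.
  by rewrite scale0r.
apply: (@not_col_repairable1 _ _ _ _ repS N2_neq0 j).
exists U, (fun=> 1); split; first by apply: contra jT; rewrite inE => /andP[].
split; last by apply/col_Nbar_eq; rewrite EU; apply: eq_bigr => l _; rewrite scale1r.
have U2 : (#|U| <= 2)%N.
  by apply: leq_trans T2; apply: subset_leq_card; apply/subsetP => l; rewrite inE => /andP[].
rewrite -ltnS ltn_neqAle U2 andbT; apply/negP => /cards2P[x [y [xy Uxy]]].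
have := s1 j; rewrite EU Uxy big_setU1 ?inE // big_set1 linearD mxE !s1 => /eqP.
by rewrite -subr_eq0 addrK oner_eq0.
Qed.

End Binary.

(** * Exact localities and the resulting code parameters *)

Lemma size_N2_gt0 : (0 < size s)%N.
Proof.
have : (0 < #|@N2 F m A B C|)%N.
  by rewrite card_N2 !muln_gt0 expn_gt0 subn_gt0 exp_A_lt (ltnW card_F_gt1).
by rewrite -(size_rep repS N2_neq0 N2_scale) muln_gt0 => /andP[].
Qed.

Lemma locality_N2_2 : (2 < q)%N \/ q = 2%N /\ (2 <= #|~: A|)%N ->
  locality (Nbar_genmx s) 2.
Proof.
move=> h; split=> //; split=> [j|[|[|r]] // _ _ hr].
  by case: h => [q3|[q2 cA]]; [exact: repair2_large | exact: repair2_binary].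
exact: not_col_repairable1 repS N2_neq0 (Ordinal size_N2_gt0) (hr _).
Qed.

Lemma locality_N2_3 : q = 2%N -> #|~: A| = 1%N -> C != set0 ->
  locality (Nbar_genmx s) 3.
Proof.
move=> q2 A1 C0; split=> //; split=> [j|r r0 r3 hr]; first exact: repair3_binary.
have [T [a [h1 [h2 h3]]]] := hr (Ordinal size_N2_gt0).
apply: (not_repair2_binary q2 A1 (j := Ordinal size_N2_gt0)).
(* A repair by at most [r < 3] columns is in particular a repair by at most 2. *)
by exists T, a; split=> //; split=> //; apply: leq_trans h2 _.
Qed.

End N2.

(** The length in the first case is multiplied by [q - 1] to avoid a quotient. Length, rank and
    distance come from one computation for all [q]; only the locality separates the two cases. *)
Theorem mainTheorem18 (q : nat) (F : finFieldType) (m : nat)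
    (A B C : {set 'I_m}) (s : seq 'rV[F]_(m + m + m)) :
  #|F| = q -> (2 <= m)%N ->
  A != set0 -> B != set0 -> C != set0 ->
  B \subset A -> A \proper [set: 'I_m] ->
  is_rep_system (N2 A B C) s ->
  let rho := (if B == A then 0 else 1)%N in
  ((3 <= q \/ (q = 2 /\ 2 <= #|~: A|))%N ->
     (size s * (q - 1) = 2 * q ^ (#|B| + #|C|) * (q ^ m - q ^ #|A|))%N /\
     is_LRC (Nbar_genmx s) (2 * m + #|C|)
       ((q ^ m - rho * q ^ #|A|) * q ^ (#|B| + #|C| - 1)) 2) /\
  (q = 2 -> #|~: A| = 1%N ->
     size s = (2 ^ (m + #|B| + #|C|))%N /\
     is_LRC (Nbar_genmx s) (2 * m + #|C|)
       ((2 - rho) * 2 ^ (m + #|B| + #|C| - 2)) 3).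
Proof.
move=> <- _ _ B0 C0 sBA pA repS rho.
have sz := size_rep repS (@N2_neq0 F m A B C) (@N2_scale F m A B C).
have rk := rank_N2 B0 sBA pA repS.
have md := min_dist_N2 B0 sBA pA repS.
rewrite (card_N2 F C sBA) in sz; split=> [h|q2 A1].
  by split=> //; split=> //; split=> //; exact: (locality_N2_2 B0 sBA pA repS h).
(* With one coordinate missing, [2 ^ m - 2 ^ #|A|] is [2 ^ #|A|], so the general formulas collapse
   to powers of 2. *)
have mA : m = #|A|.+1 by have := cardsC A; rewrite card_ord A1 addn1.
have B1 : (0 < #|B|)%N by rewrite card_gt0.
have C1 : (0 < #|C|)%N by rewrite card_gt0.
have Em : (2 ^ m = 2 * 2 ^ #|A|)%N by rewrite [in LHS]mA expnS.
split.
  have : (2 ^ (m + #|B| + #|C|) = 2 ^ m * 2 ^ (#|B| + #|C|))%N.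
    by rewrite -expnD addnA.
  by move: sz; rewrite q2 Em => + ->; lia.
split=> //; split; last exact: (locality_N2_3 B0 sBA pA repS q2 A1 C0).
move: md; rewrite q2 Em -/rho.
(* One unit of the subtracted 2 turns [m] into [#|A|]; the factor [2 ^ #|A|] is then taken out of
   the distance. *)
have -> : (2 ^ (m + #|B| + #|C| - 2) = 2 ^ #|A| * 2 ^ (#|B| + #|C| - 1))%N.
  by rewrite -expnD; congr expn; lia.
by rewrite -mulnBl mulnA.
Qed.
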